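(* Let $\rho,\sigma$ be $d\times d$ density matrices. Then the set $\{F(\rho,U\sigma U^\dagger): U\in\mathcal{U}(d)\}$ equals the closed interval \[ \Big[\sum_{j=1}^d\sqrt{\lambda^\downarrow_j(\rho)\lambda^\uparrow_j(\sigma)},\ \sum_{j=1}^d\sqrt{\lambda^\downarrow_j(\rho)\lambda^\downarrow_j(\sigma)}\Big]. \]
   Context: A density matrix is a positive semidefinite complex matrix of trace one. $\mathcal{U}(d)$ denotes the group of $d\times d$ unitary matrices. The fidelity of density matrices is $F(\rho,\sigma)=\operatorname{Tr}\sqrt{\sqrt{\rho}\,\sigma\sqrt{\rho}}$. For a Hermitian matrix $A$, $\lambda^\downarrow(A)$ is the vector of its eigenvalues (with multiplicity) in decreasing order and $\lambda^\uparrow(A)$ the same in increasing order. *)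

(* Defs.v *)
From HB Require Import structures.
From mathcomp Require Import all_boot all_order all_algebra.
Set Implicit Arguments. Unset Strict Implicit. Unset Printing Implicit Defensive.
Import Order.TTheory GRing.Theory Num.Theory Num.Def.
Local Open Scope ring_scope.

Definition adjmx (C : numClosedFieldType) m n (M : 'M[C]_(m, n)) : 'M[C]_(n, m) :=
  map_mx conjC (M^T).

Definition psdmx (C : numClosedFieldType) d (A : 'M[C]_d) : Prop :=
  A \is hermsymmx /\ forall v : 'rV[C]_d, 0 <= (v *m A *m adjmx v) 0 0.

Definition densitymx (C : numClosedFieldType) d (A : 'M[C]_d) : Prop :=
  psdmx A /\ \tr A = 1.

(* Principal (PSD) square root, via the library's unitary diagonalization
   A = P^-1 diag(x) P (spectralmx / spectral_diag): sqrt A = P^-1 diag(sqrt x) P.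
   For PSD A this is the unique PSD square root. *)
Definition sqrtmx (C : numClosedFieldType) d (A : 'M[C]_d) : 'M[C]_d :=
  invmx (spectralmx A) *m diag_mx (map_mx sqrtC (spectral_diag A)) *m spectralmx A.

Definition fidelity (C : numClosedFieldType) d (rho sigma : 'M[C]_d) : C :=
  \tr (sqrtmx (sqrtmx rho *m sigma *m sqrtmx rho)).

Definition eigs_down (C : numClosedFieldType) d (A : 'M[C]_d) : seq C :=
  sort (fun x y : C => y <= x) [seq spectral_diag A 0 i | i <- enum 'I_d].
Definition eigs_up (C : numClosedFieldType) d (A : 'M[C]_d) : seq C :=
  sort (fun x y : C => x <= y) [seq spectral_diag A 0 i | i <- enum 'I_d].

(* Main.v *)
(** Write [rho = R^* a^2 R] and [sigma = Q^* b^2 Q] with [a, b] diagonal. The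
fidelity is the trace norm of [X = sqrt(sigma') sqrt(rho)], [sigma' = U sigma U^*].

Polar decomposition gives [sqrt(X^* X) = T X] with [T] a partial isometry, so the
fidelity is the trace of a product [T1 b T2 a] with [T1, T2] partial isometries;
by AM-GM it is at most [sum_ij D_ij a_i b_j] with [D] doubly substochastic, and
rearrangement gives the upper bound. Conversely the fidelity is at least [tr X],
which is such a sum with [D] doubly stochastic, whence the lower bound.

The reals of [C] need not be complete, so the intermediate values are reached
algebraically. The permutation aligning [a] with [b] and the one reversing it are joined
by a chain of transpositions, and along one transposition a rotation in the
corresponding coordinate plane interpolates explicitly: a 2x2 positive [M] has
[(tr sqrt M)^2 = tr M + 2 sqrt(det M)], where [det M] does not depend on the angle
and [tr M] is affine in its squared sine. *)
Require Import Defs.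
From HB Require Import structures.
From mathcomp Require Import all_boot all_order all_fingroup all_algebra ring.
Import Order.TTheory GRing.Theory Num.Theory.
Local Open Scope ring_scope.

Set Implicit Arguments. Unset Strict Implicit. Unset Printing Implicit Defensive.

(** * Rearrangement for doubly (sub)stochastic matrices *)

Section Rearrangement.
Variable R : numDomainType.
Implicit Types a b : nat -> R.

(* [u i = - p i] and [v j = a j * b j + p j] are dual potentials for the assignment
   problem: [a i * b j <= u i + v j], with equality at [i = j]. *)
Lemma young_potential a b :
  {homo a : i j / (i <= j)%N >-> j <= i} ->
  {homo b : i j / (i <= j)%N >-> j <= i} ->
  let p i := \sum_(k < i) (a k - a k.+1) * b k in
  forall i j, (a i - a j) * b j <= p j - p i.
Proof.
move=> a_dec b_dec p i j.
have pS k : p k.+1 = p k + (a k - a k.+1) * b k by rewrite /p big_ord_recr.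
have a_step k : 0 <= a k - a k.+1 by rewrite subr_ge0 a_dec.
(* Moving away from [j] one index at a time, the potential changes with weight [b k] where the left
   side has [b j]. Monotonicity of [b] compares the two, upwards here and downwards in [down]. *)
have up m : (a (j + m)%N - a j) * b j <= p j - p (j + m)%N.
  elim: m => [|n IHn]; first by rewrite addn0 !subrr mul0r.
  rewrite addnS pS; set k := (j + n)%N in IHn *.
  have -> : (a k.+1 - a j) * b j = (a k - a j) * b j - (a k - a k.+1) * b j by ring.
  by rewrite opprD addrA; apply: lerB => //; rewrite ler_wpM2l // b_dec // leq_addr.
have down n m : (n + m)%N = j -> (a n - a j) * b j <= p j - p n.
  elim: m n => [|m IHm] n; first by rewrite addn0 => ->; rewrite !subrr mul0r.
  rewrite addnS -addSn => nmj; have := IHm _ nmj; rewrite pS => IH.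
  have -> : (a n - a j) * b j = (a n.+1 - a j) * b j + (a n - a n.+1) * b j by ring.
  have -> : p j - p n = p j - (p n + (a n - a n.+1) * b n) + (a n - a n.+1) * b n by ring.
  by rewrite lerD // ler_wpM2l // b_dec // -nmj addSn -addnS leq_addr.
by case: (leqP i j) => [/subnKC/down|/ltnW/subnKC <-].
Qed.

(** Weak duality for the assignment problem: nonnegative potentials [u] and [v] bound the weighted
    sum through the row and column sums of [D], and their total is exactly the aligned sum. *)
Lemma substochastic_rearrangement d (D : 'M[R]_d) a b :
  (forall i j, 0 <= D i j) ->
  (forall i, \sum_j D i j <= 1) -> (forall j, \sum_i D i j <= 1) ->
  {homo a : i j / (i <= j)%N >-> j <= i} -> (forall i, 0 <= a i) ->
  {homo b : i j / (i <= j)%N >-> j <= i} -> (forall i, 0 <= b i) ->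
  \sum_i \sum_j D i j * (a i * b j) <= \sum_(i < d) a i * b i.
Proof.
move=> D0 Drow Dcol a_dec a0 b_dec b0.
pose p i := \sum_(k < i) (a k - a k.+1) * b k.
have young : forall i j, (a i - a j) * b j <= p j - p i.
  exact: young_potential.
(* The constant [a d * b d + p d] takes the first index out of range as a sentinel. It shifts the
   potentials so that both are nonnegative below [d], as row and column sums at most 1 require. *)
pose u i := a d * b d + p d - p i; pose v i := a i * b i - u i.
have u0 i : (i < d)%N -> 0 <= u i.
  move=> /ltnW le_id; rewrite /u -addrA addr_ge0 ?mulr_ge0 //.
  by apply: le_trans (young i d); rewrite mulr_ge0 // subr_ge0 a_dec.
have v0 i : (i < d)%N -> 0 <= v i.
  move=> /ltnW le_id.
  have -> : v i = a d * (b i - b d) + ((p i - p d) - (a d - a i) * b i).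
    by rewrite /v /u; ring.
  by rewrite addr_ge0 ?mulr_ge0 // subr_ge0 ?b_dec.
have uv i j : a i * b j <= u i + v j.
  rewrite -subr_ge0; have -> : u i + v j - a i * b j = p j - p i - (a i - a j) * b j.
    by rewrite /v /u; ring.
  by rewrite subr_ge0.
have -> : \sum_(i < d) a i * b i = \sum_(i < d) u i + \sum_(j < d) v j.
  by rewrite -big_split; apply: eq_bigr => i _; rewrite /= /v addrC subrK.
apply: (@le_trans _ _ (\sum_i \sum_j D i j * (u i + v j))).
  by apply: ler_sum => i _; apply: ler_sum => j _; rewrite ler_wpM2l.
under eq_bigr do (under eq_bigr do rewrite mulrDr; rewrite big_split /=).
rewrite big_split /= [X in _ + X]exchange_big /= lerD //.
  by apply: ler_sum => i _; rewrite -mulr_suml ler_piMl ?u0.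
by apply: ler_sum => i _; rewrite -mulr_suml ler_piMl ?v0.
Qed.

(** Reflecting [b] into [B - b] makes it decreasing; since the rows of [D] sum to 1, [B] contributes
    equally to both sides and the upper bound turns into a lower one. Monotonicity of [b] is
    confined to indices below [d]: an increasing list read with default 0 drops past its end. *)
Lemma doubly_stochastic_rearrangement d (D : 'M[R]_d) a b :
  (forall i j, 0 <= D i j) ->
  (forall i, \sum_j D i j = 1) -> (forall j, \sum_i D i j = 1) ->
  {homo a : i j / (i <= j)%N >-> j <= i} -> (forall i, 0 <= a i) ->
  (forall i j, (i <= j < d)%N -> b i <= b j) -> (forall i, 0 <= b i) ->
  \sum_(i < d) a i * b i <= \sum_i \sum_j D i j * (a i * b j).
Proof.
move=> D0 Drow Dcol a_dec a0 b_inc b0.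
(* The sum serves as an upper bound of [b] below [d]. The value 0 from [d] on keeps [b'] nonnegative
   and decreasing on all indices. *)
pose B := \sum_(k < d) b k; pose b' k := if (k < d)%N then B - b k else 0.
have b'0 k : 0 <= b' k.
  rewrite /b'; case: ltnP => // lt_kd; rewrite subr_ge0 /B (bigD1 (Ordinal lt_kd)) //=.
  by rewrite lerDl sumr_ge0.
have b'_dec : {homo b' : i j / (i <= j)%N >-> j <= i}.
  move=> i j le_ij; rewrite {1}/b'; case: ltnP => // lt_jd.
  by rewrite /b' (leq_ltn_trans le_ij) // lerD2l lerN2 b_inc // le_ij.
have : \sum_i \sum_j D i j * (a i * b' j) <= \sum_(i < d) a i * b' i.
  by apply: substochastic_rearrangement => // k; rewrite (Drow, Dcol).
have -> : \sum_i \sum_j D i j * (a i * b' j)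
        = B * \sum_(i < d) a i - \sum_i \sum_j D i j * (a i * b j).
  rewrite mulr_sumr -sumrB; apply: eq_bigr => i _.
  rewrite -[B * _]mulr1 -(Drow i) mulr_sumr -sumrB; apply: eq_bigr => j _.
  by rewrite /b' ltn_ord; ring.
have -> : \sum_(i < d) a i * b' i = B * \sum_(i < d) a i - \sum_(i < d) a i * b i.
  rewrite mulr_sumr -sumrB; apply: eq_bigr => i _.
  by rewrite /b' ltn_ord; ring.
by rewrite lerD2l lerN2.
Qed.

End Rearrangement.

(** * Positive semidefinite square roots *)

Section Adjoint.
Variable C : numClosedFieldType.

Lemma adjmxK m n (A : 'M[C]_(m, n)) : adjmx (adjmx A) = A.
Proof. exact: trmxCK. Qed.

Lemma adjmxM m n p (A : 'M[C]_(m, n)) (B : 'M_(n, p)) :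
  adjmx (A *m B) = adjmx B *m adjmx A.
Proof. by rewrite /adjmx trmx_mul map_mxM. Qed.

Lemma adjmxD m n (A B : 'M[C]_(m, n)) : adjmx (A + B) = adjmx A + adjmx B.
Proof. by rewrite /adjmx linearD map_mxD. Qed.

Lemma adjmx1 n : adjmx (1%:M : 'M[C]_n) = 1%:M.
Proof. by rewrite /adjmx trmx1 map_mx1. Qed.

Lemma adjmx_diag n (x : 'rV[C]_n) : (forall i, 0 <= x 0 i) ->
  adjmx (diag_mx x) = diag_mx x.
Proof.
move=> x0; rewrite /adjmx tr_diag_mx map_diag_mx; congr diag_mx.
by apply/rowP=> i; rewrite mxE; apply: geC0_conj.
Qed.

Lemma unitarymx_adjP n (U : 'M[C]_n) :
  reflect (U *m adjmx U = 1%:M) (U \is unitarymx).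
Proof. exact: unitarymxP. Qed.

Lemma unitarymxE n (U : 'M[C]_n) : U \is unitarymx -> U *m adjmx U = 1%:M.
Proof. by move/unitarymxP. Qed.

Lemma unitarymx_adjl n (U : 'M[C]_n) : U \is unitarymx -> adjmx U *m U = 1%:M.
Proof. by move/unitarymxP/mulmx1C. Qed.

Lemma adjmx_unitary n (U : 'M[C]_n) : (adjmx U \is unitarymx) = (U \is unitarymx).
Proof. exact: trmxC_unitary. Qed.

Lemma gram_diagE m n (A : 'M[C]_(m, n)) i :
  (A *m adjmx A) i i = \sum_j `|A i j| ^+ 2.
Proof. by rewrite mxE; apply: eq_bigr => j _; rewrite !mxE normCK. Qed.

Lemma gram_eq0 m n (A : 'M[C]_(m, n)) : A *m adjmx A = 0 -> A = 0.
Proof.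
move=> A0; apply/matrixP=> i j; rewrite mxE.
have := gram_diagE A i; rewrite A0 mxE => /esym/psumr_eq0P Ai0.
have /eqP : `|A i j| ^+ 2 = 0 by apply: Ai0 => // k _; rewrite exprn_ge0.
by rewrite expf_eq0 normr_eq0 => /eqP.
Qed.

Lemma hermsymmxE n (A : 'M[C]_n) : (A \is hermsymmx) = (adjmx A == A).
Proof. by rewrite is_hermitianmxE expr0 scale1r eq_sym. Qed.

Lemma psd_adj d (A : 'M[C]_d) : psdmx A -> adjmx A = A.
Proof. by case; rewrite hermsymmxE => /eqP. Qed.

Lemma psd_gram m n (A : 'M[C]_(m, n)) : psdmx (A *m adjmx A).
Proof.
split; first by rewrite hermsymmxE adjmxM adjmxK.
move=> v; rewrite mulmxA -mulmxA -adjmxM gram_diagE sumr_ge0 // => j _.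
by rewrite exprn_ge0.
Qed.

Lemma psd_conj m n (P : 'M[C]_(m, n)) (A : 'M[C]_m) :
  psdmx A -> psdmx (adjmx P *m A *m P).
Proof.
move=> Apsd; split.
  by rewrite hermsymmxE !adjmxM adjmxK psd_adj // mulmxA.
move=> v; have := Apsd.2 (v *m adjmx P).
by rewrite adjmxM adjmxK !mulmxA.
Qed.

Lemma psdD n (A B : 'M[C]_n) : psdmx A -> psdmx B -> psdmx (A + B).
Proof.
move=> Ap Bp; split.
  by rewrite hermsymmxE adjmxD !psd_adj.
by move=> v; rewrite mulmxDr mulmxDl mxE addr_ge0 ?Ap.2 ?Bp.2.
Qed.

Lemma psdZ n (c : C) (A : 'M[C]_n) : 0 <= c -> psdmx A -> psdmx (c *: A).
Proof.
move=> c0 Ap; split.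
  rewrite hermsymmxE.
  by rewrite /adjmx linearZ map_mxZ -/(adjmx A) psd_adj //= geC0_conj.
by move=> v; rewrite -scalemxAr -scalemxAl mxE mulr_ge0 ?Ap.2.
Qed.

Lemma psd1 n : psdmx (1%:M : 'M[C]_n).
Proof. by rewrite -[1%:M]mulmx1 -{2}adjmx1; apply: psd_gram. Qed.

Lemma diag_sqrtCK n (x : 'rV[C]_n) :
  diag_mx (map_mx sqrtC x) *m diag_mx (map_mx sqrtC x) = diag_mx x.
Proof. by rewrite mulmx_diag; congr diag_mx; apply/rowP=> i; rewrite !mxE -expr2 sqrtCK. Qed.

Lemma psd_diag n (x : 'rV[C]_n) : (forall i, 0 <= x 0 i) -> psdmx (diag_mx x).
Proof.
move=> x0; rewrite -diag_sqrtCK -{2}[diag_mx (map_mx _ _)]adjmx_diag; first exact: psd_gram.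
by move=> i; rewrite mxE sqrtC_ge0.
Qed.

Lemma psd_spectralE d (A : 'M[C]_d) : psdmx A ->
  A = adjmx (spectralmx A) *m diag_mx (spectral_diag A) *m spectralmx A.
Proof.
case=> /hermitian_normalmx/orthomx_spectralP AE _.
by rewrite -[adjmx _]invmx_unitary ?spectral_unitarymx.
Qed.

(** The eigenvalue is the quadratic form of [P A P^*] at the [i]-th basis vector, with [P] the
    diagonalizing unitary. *)
Lemma spectral_diag_ge0 d (A : 'M[C]_d) i : psdmx A -> 0 <= spectral_diag A 0 i.
Proof.
move=> Apsd; have PU := spectral_unitarymx A.
have := (psd_conj (adjmx (spectralmx A)) Apsd).2 (delta_mx 0 i).
rewrite adjmxK {2}(psd_spectralE Apsd) !mulmxA mulmxtVK // -!mulmxA.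
rewrite (mulmxA (spectralmx A)) unitarymxE // mul1mx.
rewrite mulmxA -rowE row_diag_mx -scalemxAl mxE mxE (bigD1 i) //= big1 => [|j jNi].
  by rewrite !mxE !eqxx !conjC1 mulr1 addr0 mulr1.
by rewrite !mxE (negPf jNi) mulr0n !mul0r.
Qed.

Lemma sqrtmxE d (A : 'M[C]_d) : sqrtmx A =
  adjmx (spectralmx A) *m diag_mx (map_mx sqrtC (spectral_diag A)) *m spectralmx A.
Proof. by rewrite /sqrtmx invmx_unitary ?spectral_unitarymx. Qed.

Lemma sqrtmx_psd d (A : 'M[C]_d) : psdmx A -> psdmx (sqrtmx A).
Proof.
move=> Apsd; rewrite sqrtmxE; apply/psd_conj/psd_diag => i.
by rewrite mxE sqrtC_ge0 spectral_diag_ge0.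
Qed.

(* If [P^* D P = Q^* E^2 Q], then [T = P Q^*] satisfies [D T = T E^2], that is
   [T_ij (d_i - e_j^2) = 0]; hence [sqrt(D) T = T E]. *)
Lemma sqrtmx_sqr d (S : 'M[C]_d) : psdmx S -> sqrtmx (S *m S) = S.
Proof.
move=> Spsd; have Mpsd : psdmx (S *m S) by rewrite -{2}(psd_adj Spsd); apply: psd_gram.
set M := S *m S in Mpsd *.
have [PU QU] := (spectral_unitarymx M, spectral_unitarymx S).
have E0 i := spectral_diag_ge0 i Spsd.
have := psd_spectralE Mpsd; have := psd_spectralE Spsd; rewrite sqrtmxE.
set P := spectralmx M in PU *; set Q := spectralmx S in QU *.
set x := spectral_diag M; set e := spectral_diag S in E0 *.
move=> SE ME; pose T := P *m adjmx Q.
have TE : diag_mx x *m T = T *m diag_mx e *m diag_mx e.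
  have -> : diag_mx x = P *m M *m adjmx P.
    by rewrite ME !mulmxA unitarymxE // mul1mx -mulmxA unitarymxE // mulmx1.
  have SQ : S *m adjmx Q = adjmx Q *m diag_mx e by rewrite {1}SE -mulmxA unitarymxE // mulmx1.
  by rewrite /T /M !mulmxA mulmxKtV // -!mulmxA SQ (mulmxA S) SQ -mulmxA.
suff TE1 : diag_mx (map_mx sqrtC x) *m T = T *m diag_mx e.
  rewrite [RHS]SE -[adjmx Q]mul1mx -(unitarymx_adjl PU) -!mulmxA (mulmxA P) -/T.
  rewrite (mulmxA T) -TE1 /T.
  by rewrite -!mulmxA unitarymx_adjl // mulmx1.
apply/matrixP=> i j; move: T TE => {}T /matrixP/(_ i j).
rewrite !mul_diag_mx !mul_mx_diag !mxE => TEij.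
have [-> | T0] := eqVneq (T i j) 0; first by rewrite mulr0 mul0r.
rewrite mulrC; congr (_ * _).
have -> : x 0 i = e 0 j ^+ 2 by apply: (mulfI T0); rewrite mulrC TEij expr2 mulrA.
by rewrite sqrCK.
Qed.

Lemma sqrtmxK d (A : 'M[C]_d) : psdmx A -> sqrtmx A *m sqrtmx A = A.
Proof.
move=> Apsd; rewrite [RHS](psd_spectralE Apsd) !sqrtmxE.
rewrite -(diag_sqrtCK (spectral_diag A)) -!mulmxA (mulmxA (spectralmx A) (adjmx _)).
by rewrite unitarymxE ?spectral_unitarymx // mul1mx.
Qed.

End Adjoint.

(** * Bounds on the fidelity *)

Section Bounds.
Variable C : numClosedFieldType.

(** Working with partial isometries instead of unitaries gives a polar factor for singular matrices
    without completing an orthonormal family. *)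
Definition partial_isometry m n (T : 'M[C]_(m, n)) := T *m adjmx T *m T = T.

Lemma partial_isometry_adj m n (T : 'M[C]_(m, n)) :
  partial_isometry T -> partial_isometry (adjmx T).
Proof. by move=> /(congr1 (@adjmx C _ _)); rewrite /partial_isometry !adjmxM mulmxA. Qed.

Lemma partial_isometryM d (T U V : 'M[C]_d) : U \is unitarymx -> V \is unitarymx ->
  partial_isometry T -> partial_isometry (U *m T *m V).
Proof.
move=> UU VU TP; rewrite /partial_isometry !adjmxM !mulmxA mulmxtVK //.
by rewrite mulmxKtV // -(mulmxA U T) -(mulmxA U _ T) TP.
Qed.

Lemma unitary_partial_isometry d (U : 'M[C]_d) :
  U \is unitarymx -> partial_isometry U.
Proof. by move=> UU; rewrite /partial_isometry unitarymxE // mul1mx. Qed.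

(* [Q = T T^*] is a projection, so [Q_ii = sum_j |Q_ij|^2 >= Q_ii^2]. *)
Lemma partial_isometry_row m n (T : 'M[C]_(m, n)) i : partial_isometry T ->
  \sum_j `|T i j| ^+ 2 <= 1.
Proof.
move=> TP; rewrite -gram_diagE; set q := (T *m adjmx T) i i.
have q0 : 0 <= q by rewrite /q gram_diagE sumr_ge0 // => j _; rewrite exprn_ge0.
have : q ^+ 2 <= q.
  have QQ : T *m adjmx T = T *m adjmx T *m adjmx (T *m adjmx T).
    by rewrite adjmxM adjmxK mulmxA TP.
  rewrite {2}/q QQ gram_diagE (bigD1 i) //= -/q ger0_norm // lerDl sumr_ge0 // => j _.
  by rewrite exprn_ge0.
rewrite expr2; have [->|qN0] := eqVneq q 0; first by rewrite ler01.
by rewrite ger_pMr // lt_def qN0.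
Qed.

Lemma partial_isometry_col m n (T : 'M[C]_(m, n)) j : partial_isometry T ->
  \sum_i `|T i j| ^+ 2 <= 1.
Proof.
move=> /partial_isometry_adj/partial_isometry_row-/(_ j); congr (_ <= _).
by apply: eq_bigr => i _; rewrite !mxE norm_conjC.
Qed.

Lemma partial_isometry_norm m n (T : 'M[C]_(m, n)) i j : partial_isometry T ->
  `|T i j| <= 1.
Proof.
move=> /partial_isometry_row-/(_ i); rewrite (bigD1 j) //= => le1.
rewrite -(@ler_pXn2r _ 2) ?nnegrE // expr1n; apply: le_trans le1.
by rewrite lerDl sumr_ge0 // => k _; rewrite exprn_ge0.
Qed.

(* [X P^*] has orthogonal columns; normalizing the nonzero ones gives [T^* P^*]. *)
Lemma polar_decomposition d (X : 'M[C]_d) : exists T : 'M[C]_d,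
  [/\ partial_isometry T, sqrtmx (adjmx X *m X) = T *m X
    & X = adjmx T *m sqrtmx (adjmx X *m X)].
Proof.
have Mpsd : psdmx (adjmx X *m X) by rewrite -{2}(adjmxK X); apply: psd_gram.
have := psd_spectralE Mpsd; rewrite sqrtmxE.
have := fun i => spectral_diag_ge0 i Mpsd; have := spectral_unitarymx (adjmx X *m X).
move: (spectralmx _) (spectral_diag _) => P x PU x0 ME.
(* Since the inverse of 0 is 0, [f] is a pseudo-inverse: it normalizes the nonzero columns of [Y]
   and kills the others. *)
pose f := map_mx (fun y => (sqrtC y)^-1) x; pose Y := X *m adjmx P.
have f0 i : 0 <= f 0 i by rewrite mxE invr_ge0 sqrtC_ge0.
have YY : adjmx Y *m Y = diag_mx x.
  rewrite adjmxM adjmxK -!mulmxA (mulmxA (adjmx X)) ME !mulmxA unitarymxE // mul1mx.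
  by rewrite -mulmxA unitarymxE // mulmx1.
have XE : X = Y *m P by rewrite mulmxKtV.
clearbody Y.
have fx : diag_mx f *m diag_mx x = diag_mx (map_mx sqrtC x).
  rewrite mulmx_diag; congr diag_mx; apply/rowP=> i; rewrite !mxE.
  have [->|xN0] := eqVneq (x 0 i) 0; first by rewrite sqrtC0 mulr0.
  by rewrite -{2}[x 0 i]sqrtCK expr2 mulKf // sqrtC_eq0.
(* The product of the two diagonals is the projection on the support of [x]. It fixes [Y] because a
   column of [Y] with [x 0 i = 0] has norm zero, which the Gram matrix of the difference detects. *)
have Yf : Y *m (diag_mx f *m diag_mx (map_mx sqrtC x)) = Y.
  apply/eqP; rewrite -subr_eq0; apply/eqP; set e := _ *m diag_mx _.
  have -> : Y *m e - Y = Y *m (e - 1%:M) by rewrite mulmxBr mulmx1.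
  rewrite -[LHS]adjmxK -[RHS]adjmxK; congr adjmx.
  rewrite [RHS]/adjmx trmx0 map_mx0; apply: gram_eq0.
  rewrite adjmxK adjmxM -mulmxA (mulmxA (adjmx Y)) YY /e mulmx_diag -diag_const_mx -linearB.
  rewrite mulmx_diag -[X in _ *m X = _]/(diag_mx _).
  suff -> : \row_j (x 0 j
      * ((\row_j0 (f 0 j0 * map_mx sqrtC x 0 j0)) - const_mx 1) 0 j) = 0 :> 'rV_d.
    by rewrite linear0 mulmx0.
  apply/rowP=> i; rewrite !mxE.
  have [->|xN0] := eqVneq (x 0 i) 0; first by rewrite mul0r.
  by rewrite mulVf ?sqrtC_eq0 // subrr mulr0.
exists (adjmx P *m diag_mx f *m adjmx Y); split.
- rewrite /partial_isometry !adjmxM !adjmxK (adjmx_diag f0).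
  rewrite -!mulmxA; congr (_ *m _); rewrite (mulmxA (adjmx Y)) YY.
  rewrite (mulmxA P) unitarymxE // mul1mx !mulmxA fx; congr (_ *m _).
  rewrite !mulmx_diag; congr diag_mx; apply/rowP=> i; rewrite !mxE.
  have [->|xN0] := eqVneq (x 0 i) 0; first by rewrite sqrtC0 invr0 !mulr0.
  by rewrite divff ?mul1r ?sqrtC_eq0.
- by rewrite XE -!mulmxA (mulmxA (adjmx Y)) YY (mulmxA (diag_mx f)) fx.
- rewrite !adjmxM !adjmxK (adjmx_diag f0) !mulmxA mulmxtVK //.
  by rewrite -(mulmxA Y) Yf.
Qed.

Lemma trace_mul_diag d (T1 T2 : 'M[C]_d) (a b : 'rV[C]_d) :
  \tr (T1 *m diag_mx b *m T2 *m diag_mx a)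
  = \sum_i \sum_j T1 i j * T2 j i * (a 0 i * b 0 j).
Proof.
apply: eq_bigr => i _; rewrite mul_mx_diag mxE mxE mulr_suml; apply: eq_bigr => j _.
by rewrite mul_mx_diag mxE; ring.
Qed.

Lemma sum_perm2 d (r s : 'S_d) (F : 'I_d -> 'I_d -> C) :
  \sum_i \sum_j F i j = \sum_i \sum_j F (r i) (s j).
Proof.
rewrite (reindex_inj (@perm_inj _ r)); apply: eq_bigr => i _.
by rewrite (reindex_inj (@perm_inj _ s)).
Qed.

(* By AM-GM, [|x y| <= (|x|^2 + |y|^2) / 2] turns the two partial isometries
   into one doubly substochastic matrix. *)
Lemma von_neumann_trace_le d (T1 T2 : 'M[C]_d) (a b : 'rV[C]_d)
    (fa fb : nat -> C) (r s : 'S_d) :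
  partial_isometry T1 -> partial_isometry T2 ->
  {homo fa : i j / (i <= j)%N >-> j <= i} -> (forall i, 0 <= fa i) ->
  {homo fb : i j / (i <= j)%N >-> j <= i} -> (forall i, 0 <= fb i) ->
  (forall i, a 0 (r i) = fa i) -> (forall i, b 0 (s i) = fb i) ->
  `|\tr (T1 *m diag_mx b *m T2 *m diag_mx a)| <= \sum_(i < d) fa i * fb i.
Proof.
move=> T1P T2P fa_dec fa0 fb_dec fb0 aE bE.
pose D := \matrix_(i, j) ((`|T1 (r i) (s j)| ^+ 2 + `|T2 (s j) (r i)| ^+ 2) / 2).
rewrite trace_mul_diag (sum_perm2 r s).
apply: le_trans (_ : \sum_i \sum_j D i j * (fa i * fb j) <= _).
  apply: le_trans (ler_norm_sum _ _ _) _; apply: ler_sum => i _.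
  apply: le_trans (ler_norm_sum _ _ _) _; apply: ler_sum => j _.
  rewrite aE bE normrM [X in _ * X]ger0_norm ?mulr_ge0 // ler_wpM2r ?mulr_ge0 //.
  rewrite normrM mxE ler_pdivlMr ?ltr0n // -subr_ge0.
  set x := `|T1 _ _|; set y := `|T2 _ _|.
  have -> : x ^+ 2 + y ^+ 2 - x * y * 2 = (x - y) ^+ 2 by ring.
  by rewrite real_exprn_even_ge0 // rpredB ?normr_real.
have half : 1 = (1 + 1) / 2 :> C by rewrite -(natrD _ 1 1) divff // pnatr_eq0.
apply: substochastic_rearrangement => // [i j|i|j].
- by rewrite mxE divr_ge0 ?ler0n // addr_ge0 // exprn_ge0.
- under eq_bigr do rewrite mxE.
  rewrite -mulr_suml big_split /= [leRHS]half ler_wpM2r ?invr_ge0 ?ler0n // lerD //.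
    by have := partial_isometry_row (r i) T1P; rewrite (reindex_perm s).
  by have := partial_isometry_col (r i) T2P; rewrite (reindex_perm s).
- under eq_bigr do rewrite mxE.
  rewrite -mulr_suml big_split /= [leRHS]half ler_wpM2r ?invr_ge0 ?ler0n // lerD //.
    by have := partial_isometry_col (s j) T1P; rewrite (reindex_perm r).
  by have := partial_isometry_row (s j) T2P; rewrite (reindex_perm r).
Qed.

(** The two unitary factors being adjoint, the weights are the squared moduli of the entries of [H],
    a doubly stochastic matrix. *)
Lemma trace_conj_diag_ge d (H : 'M[C]_d) (a b : 'rV[C]_d)
    (fa fb : nat -> C) (r s : 'S_d) :
  H \is unitarymx ->
  {homo fa : i j / (i <= j)%N >-> j <= i} -> (forall i, 0 <= fa i) ->
  (forall i j, (i <= j < d)%N -> fb i <= fb j) -> (forall i, 0 <= fb i) ->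
  (forall i, a 0 (r i) = fa i) -> (forall i, b 0 (s i) = fb i) ->
  \sum_(i < d) fa i * fb i <= \tr (adjmx H *m diag_mx b *m H *m diag_mx a).
Proof.
move=> HU fa_dec fa0 fb_inc fb0 aE bE.
pose D := \matrix_(i, j) (`|H (s j) (r i)| ^+ 2).
rewrite trace_mul_diag (sum_perm2 r s).
have -> : \sum_i \sum_j adjmx H (r i) (s j) * H (s j) (r i) * (a 0 (r i) * b 0 (s j))
        = \sum_i \sum_j D i j * (fa i * fb j).
  by apply: eq_bigr => i _; apply: eq_bigr => j _; rewrite aE bE !mxE normCKC.
apply: doubly_stochastic_rearrangement => // [i j|i|j].
- by rewrite mxE exprn_ge0.
- under eq_bigr do rewrite mxE.
  have := gram_diagE (adjmx H) (r i).
  rewrite (reindex_perm s) adjmxK unitarymx_adjl // mxE eqxx => /esym; apply: etrans.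
  by apply: eq_bigr => j _; rewrite !mxE norm_conjC.
- under eq_bigr do rewrite mxE.
  have := gram_diagE H (s j).
  by rewrite (reindex_perm r) unitarymxE // mxE eqxx => /esym.
Qed.

(** In an eigenbasis of the root, polar decomposition writes [tr X] as the sum of its eigenvalues
    weighted by diagonal entries of a partial isometry, each of modulus at most 1. *)
Lemma norm_trace_le_trace_abs d (X : 'M[C]_d) :
  `|\tr X| <= \tr (sqrtmx (adjmx X *m X)).
Proof.
have Mpsd : psdmx (adjmx X *m X) by rewrite -{2}(adjmxK X); apply: psd_gram.
have [T [TP _ {1}->]] := polar_decomposition X.
have := fun i => spectral_diag_ge0 i Mpsd; have := spectral_unitarymx (adjmx X *m X).
rewrite sqrtmxE; move: (spectralmx _) (spectral_diag _) => P x PU x0.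
rewrite mulmxA mxtrace_mulC [leRHS]mxtrace_mulC !mulmxA unitarymxE // mul1mx.
have TP' : partial_isometry (P *m adjmx T *m adjmx P).
  by apply: partial_isometryM (partial_isometry_adj TP); rewrite ?adjmx_unitary.
move: (P *m adjmx T *m adjmx P) TP' => Q QP.
apply: le_trans (ler_norm_sum _ _ _) _; apply: ler_sum => i _.
rewrite mul_mx_diag !mxE eqxx mulr1n.
rewrite normrM [X in _ * X]ger0_norm ?sqrtC_ge0 //.
by rewrite ler_piMl ?sqrtC_ge0 // partial_isometry_norm.
Qed.

Lemma fidelityE d (rho sigma : 'M[C]_d) : psdmx rho -> psdmx sigma ->
  fidelity rho sigma =
  \tr (sqrtmx (adjmx (sqrtmx sigma *m sqrtmx rho) *m (sqrtmx sigma *m sqrtmx rho))).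
Proof.
move=> rho_psd sigma_psd.
rewrite adjmxM !psd_adj; try exact: sqrtmx_psd.
rewrite /fidelity -{1}(sqrtmxK sigma_psd); congr (\tr (sqrtmx _)).
by move: (sqrtmx sigma) (sqrtmx rho) => S R; rewrite !mulmxA.
Qed.

(** The diagonalization chosen for the conjugate may be unrelated to the one chosen for [A], so the
    argument goes through uniqueness of the positive root. *)
Lemma sqrtmx_conj d (U A : 'M[C]_d) : U \is unitarymx -> psdmx A ->
  sqrtmx (U *m A *m adjmx U) = U *m sqrtmx A *m adjmx U.
Proof.
move=> UU Apsd; rewrite -[RHS]sqrtmx_sqr; last first.
  by rewrite -{1}(adjmxK U); apply/psd_conj/sqrtmx_psd.
congr sqrtmx; rewrite -{1}(sqrtmxK Apsd); move: (sqrtmx A) => S.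
by rewrite !mulmxA mulmxKtV.
Qed.

Lemma psd_unitary_conj d (U A : 'M[C]_d) : psdmx A -> psdmx (U *m A *m adjmx U).
Proof. by move=> Apsd; rewrite -{1}(adjmxK U); apply: psd_conj. Qed.

(** An arbitrary relation [le] lets the same statement serve both sorting orders. *)
Lemma spectral_perm d (A : 'M[C]_d) (le : rel C) : exists s : 'S_d, forall i : 'I_d,
  spectral_diag A 0 (s i) = (sort le [seq spectral_diag A 0 i | i <- enum 'I_d])`_i.
Proof.
set t := [tuple spectral_diag A 0 i | i < d].
have /tuple_permP[s sE] : perm_eq (sort le t) t by rewrite perm_sort.
exists s => i; rewrite -[X in sort _ X]/(tval t) sE.
by rewrite -tnth_nth !tnth_mktuple.
Qed.

Lemma eigs_down_ge0 d (A : 'M[C]_d) i : psdmx A -> 0 <= (eigs_down A)`_i.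
Proof.
move=> Apsd; case: (ltnP i (size (eigs_down A))) => [lt_i|/(nth_default 0)->//].
have := mem_nth 0 lt_i; rewrite mem_sort => /mapP[j _ ->].
exact: spectral_diag_ge0.
Qed.

Lemma eigs_up_ge0 d (A : 'M[C]_d) i : psdmx A -> 0 <= (eigs_up A)`_i.
Proof.
move=> Apsd; case: (ltnP i (size (eigs_up A))) => [lt_i|/(nth_default 0)->//].
have := mem_nth 0 lt_i; rewrite mem_sort => /mapP[j _ ->].
exact: spectral_diag_ge0.
Qed.

(** The order of [C] is partial but total on nonnegative elements, which sorting can rely on. Past
    the end, the default 0 continues the decrease. *)
Lemma eigs_down_le d (A : 'M[C]_d) i j : psdmx A -> (i <= j)%N ->
  (eigs_down A)`_j <= (eigs_down A)`_i.
Proof.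
move=> Apsd le_ij.
case: (ltnP j (size (eigs_down A))) => [lt_j|/(nth_default 0)->]; last exact: eigs_down_ge0.
have srt : sorted (fun x y : C => y <= x) (eigs_down A).
  apply: (@sort_sorted_in _ Num.nneg) => [x y x0 y0|].
    by rewrite real_leVge ?ger0_real.
  by apply/allP => _ /mapP[k _ ->]; apply: spectral_diag_ge0.
apply: (sorted_leq_nth _ _ 0 srt) => //; rewrite ?inE ?(leq_ltn_trans le_ij) //.
by move=> x y z xy yz; apply: le_trans yz xy.
Qed.

(** Here the default 0 would break monotonicity, hence the bound on [j]. *)
Lemma eigs_up_le d (A : 'M[C]_d) i j : psdmx A -> (i <= j < d)%N ->
  (eigs_up A)`_i <= (eigs_up A)`_j.
Proof.
move=> Apsd /andP[le_ij lt_j].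
have srt : sorted (fun x y : C => x <= y) (eigs_up A).
  apply: (@sort_sorted_in _ Num.nneg) => [x y x0 y0|].
    by rewrite real_leVge ?ger0_real.
  by apply/allP => _ /mapP[k _ ->]; apply: spectral_diag_ge0.
have szA : size (eigs_up A) = d by rewrite size_sort size_map size_enum_ord.
apply: (sorted_leq_nth le_trans lexx 0 srt) => //; rewrite ?inE szA //.
exact: leq_ltn_trans lt_j.
Qed.

Lemma fidelity_le d (rho sigma U : 'M[C]_d) : psdmx rho -> psdmx sigma -> U \is unitarymx ->
  fidelity rho (U *m sigma *m adjmx U)
    <= \sum_(j < d) sqrtC ((eigs_down rho)`_j * (eigs_down sigma)`_j).
Proof.
move=> rho_psd sigma_psd UU; rewrite fidelityE //; last exact: psd_unitary_conj.
set X := _ *m sqrtmx rho.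
have F0 : 0 <= \tr (sqrtmx (adjmx X *m X)).
  by apply: le_trans (norm_trace_le_trace_abs X).
rewrite -(ger0_norm F0); have [T [TP -> _]] := polar_decomposition X.
rewrite /X sqrtmx_conj // !sqrtmxE.
have [r rE] := spectral_perm rho (fun x y => y <= x).
have [s sE] := spectral_perm sigma (fun x y => y <= x).
have [RU QU] := (spectral_unitarymx rho, spectral_unitarymx sigma).
move: (spectralmx rho) (spectralmx sigma) RU QU => R Q RU QU.
(* Cycling [R] to the front gives [tr (T1 b T2 a)] with [T1 = R T U Q^*] a partial isometry and
   [T2 = Q U^* R^*] unitary. *)
rewrite !mulmxA mxtrace_mulC !mulmxA -(mulmxA _ Q) -(mulmxA _ _ (adjmx R)).
rewrite -(mulmxA _ U).
under [leRHS]eq_bigr do rewrite sqrtCM ?nnegrE ?eigs_down_ge0 //.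
apply: (@von_neumann_trace_le d _ _ _ _ (fun i => sqrtC (eigs_down rho)`_i)
  (fun i => sqrtC (eigs_down sigma)`_i) r s).
- apply: partial_isometryM => //.
  by rewrite mul_unitarymx // adjmx_unitary.
- by apply: unitary_partial_isometry; rewrite !mul_unitarymx // adjmx_unitary.
- by move=> i j le_ij; rewrite ler_sqrtC ?nnegrE ?eigs_down_ge0 // eigs_down_le.
- by move=> i; rewrite sqrtC_ge0 eigs_down_ge0.
- by move=> i j le_ij; rewrite ler_sqrtC ?nnegrE ?eigs_down_ge0 // eigs_down_le.
- by move=> i; rewrite sqrtC_ge0 eigs_down_ge0.
- by move=> i; rewrite mxE rE.
- by move=> i; rewrite mxE sE.
Qed.

Lemma fidelity_ge d (rho sigma U : 'M[C]_d) : psdmx rho -> psdmx sigma -> U \is unitarymx ->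
  \sum_(j < d) sqrtC ((eigs_down rho)`_j * (eigs_up sigma)`_j)
    <= fidelity rho (U *m sigma *m adjmx U).
Proof.
move=> rho_psd sigma_psd UU; rewrite fidelityE //; last exact: psd_unitary_conj.
apply: le_trans (norm_trace_le_trace_abs _).
rewrite sqrtmx_conj // !sqrtmxE.
have [r rE] := spectral_perm rho (fun x y => y <= x).
have [s sE] := spectral_perm sigma (fun x y => x <= y).
have [RU QU] := (spectral_unitarymx rho, spectral_unitarymx sigma).
move: (spectralmx rho) (spectralmx sigma) RU QU => R Q RU QU.
rewrite !mulmxA mxtrace_mulC !mulmxA -(mulmxA _ Q) -(mulmxA _ _ (adjmx R)).
have -> : R *m U *m adjmx Q = adjmx (Q *m adjmx U *m adjmx R).
  by rewrite !adjmxM !adjmxK mulmxA.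
set y := \tr _; suff le_y : \sum_(j < d) sqrtC ((eigs_down rho)`_j * (eigs_up sigma)`_j) <= y.
  rewrite ger0_norm //; apply: le_trans le_y; apply: sumr_ge0 => j _.
  by rewrite sqrtC_ge0 mulr_ge0 ?eigs_down_ge0 ?eigs_up_ge0.
under eq_bigr do rewrite sqrtCM ?nnegrE ?eigs_down_ge0 ?eigs_up_ge0 //.
apply: (@trace_conj_diag_ge d _ _ _ (fun i => sqrtC (eigs_down rho)`_i)
  (fun i => sqrtC (eigs_up sigma)`_i) r s).
- by rewrite !mul_unitarymx // adjmx_unitary.
- by move=> i j le_ij; rewrite ler_sqrtC ?nnegrE ?eigs_down_ge0 // eigs_down_le.
- by move=> i; rewrite sqrtC_ge0 eigs_down_ge0.
- by move=> i j le_ij; rewrite ler_sqrtC ?nnegrE ?eigs_up_ge0 // eigs_up_le.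
- by move=> i; rewrite sqrtC_ge0 eigs_up_ge0.
- by move=> i; rewrite mxE rE.
- by move=> i; rewrite mxE sE.
Qed.
End Bounds.

(** * Attained values *)

Section Attained.
Variable C : numClosedFieldType.

(* [tr sqrt(N N^* )] is the fidelity of [diag a^2] and [V (diag b^2) V^*]; the
   square root is witnessed by [S] rather than computed. *)
Definition attained d (a b : 'rV[C]_d) (x : C) : Prop :=
  exists V S : 'M[C]_d, let N := diag_mx a *m V *m diag_mx b in
  [/\ V \is unitarymx, psdmx S, S *m S = N *m adjmx N & \tr S = x].

Lemma ord2P (i : 'I_2) : i = 0 \/ i = 1.
Proof. by case: i => [[|[|//]] hi]; [left | right]; apply: val_inj. Qed.

Lemma adjmxE m n (A : 'M[C]_(m, n)) i j : adjmx A i j = (A j i)^*.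
Proof. by rewrite !mxE. Qed.

Lemma mx2_eq (A B : 'M[C]_2) : A 0 0 = B 0 0 -> A 0 1 = B 0 1 ->
  A 1 0 = B 1 0 -> A 1 1 = B 1 1 -> A = B.
Proof.
move=> e00 e01 e10 e11; apply/matrixP => i j.
by case: (ord2P i) => ->; case: (ord2P j) => ->.
Qed.

Lemma sum2E (F : 'I_2 -> C) : \sum_i F i = F 0 + F 1.
Proof. by rewrite big_ord_recl big_ord1; congr (_ + F _); apply: val_inj. Qed.

(** By Cayley-Hamilton, [M^2 + e^2 = (tr M) M] when [e^2 = det M]; hence
    [(M + e)^2 = (tr M + 2 e) M = x^2 M]. *)
Lemma sqrt_mx2 (M : 'M[C]_2) (e x : C) : x != 0 ->
  M 0 0 * M 1 1 - M 0 1 * M 1 0 = e ^+ 2 -> M 0 0 + M 1 1 + e *+ 2 = x ^+ 2 ->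
  let S := x^-1 *: (M + e%:M) in S *m S = M /\ \tr S = x.
Proof.
move=> xN0 detM trM S.
have e2 : M 0 1 * M 1 0 = M 0 0 * M 1 1 - e ^+ 2 by rewrite -detM; ring.
split; last first.
  by rewrite /mxtrace sum2E !mxE !eqxx !mulr1n -mulrDr addrACA -mulr2n trM expr2 mulKf.
have SS : S *m S = x ^- 2 *: ((M + e%:M) *m (M + e%:M)).
  by rewrite -scalemxAl -scalemxAr scalerA -invfM.
suff MM : (M + e%:M) *m (M + e%:M) = x ^+ 2 *: M.
  by rewrite SS MM scalerA mulVf ?expf_neq0 // scale1r.
rewrite -trM; apply: mx2_eq; rewrite mxE sum2E !mxE ?eqxx ?mulr1n ?mulr0n.
- by ring: e2.
- by ring.
- by ring.
- by ring: e2.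
Qed.

Lemma rotation_interpolation (a b : 'rV[C]_2) (x : C) :
  (forall i, 0 <= a 0 i) -> (forall i, 0 <= b 0 i) ->
  a 0 0 * b 0 0 + a 0 1 * b 0 1 < x < a 0 0 * b 0 1 + a 0 1 * b 0 0 ->
  attained a b x.
Proof.
set P := a 0 0 * b 0 0 + _; set Q := a 0 0 * b 0 1 + _.
move=> a0 b0 /andP[ltPx ltxQ].
have P0 : 0 <= P by rewrite addr_ge0 ?mulr_ge0.
have x0 : 0 < x := le_lt_trans P0 ltPx.
have ltPx2 : 0 < x ^+ 2 - P ^+ 2 by rewrite subr_gt0 ltr_pXn2r ?nnegrE ?P0 ?(ltW x0).
have ltxQ2 : 0 < Q ^+ 2 - x ^+ 2.
  by rewrite subr_gt0 ltr_pXn2r ?nnegrE ?(ltW x0) ?(ltW (lt_trans x0 ltxQ)).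
have ltPQ2 : 0 < Q ^+ 2 - P ^+ 2 by have := addr_gt0 ltxQ2 ltPx2; rewrite addrA subrK.
(* The squares of [c] and [s] solve [c^2 + s^2 = 1] and [c^2 P^2 + s^2 Q^2 = x^2]; the strict
   inequalities keep the denominator nonzero. *)
pose s := sqrtC ((x ^+ 2 - P ^+ 2) / (Q ^+ 2 - P ^+ 2)).
pose c := sqrtC ((Q ^+ 2 - x ^+ 2) / (Q ^+ 2 - P ^+ 2)).
have s0 : 0 <= s by rewrite sqrtC_ge0 divr_ge0 ?ltW.
have c0 : 0 <= c by rewrite sqrtC_ge0 divr_ge0 ?ltW.
have cs1 : c ^+ 2 + s ^+ 2 = 1.
  by rewrite !sqrtCK -mulrDl addrA subrK divff // gt_eqF.
have csx : c ^+ 2 * P ^+ 2 + s ^+ 2 * Q ^+ 2 = x ^+ 2.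
  by rewrite !sqrtCK; field; rewrite gt_eqF.
clearbody s c.
pose R : 'M[C]_2 := \matrix_(i, j) (if i == j then c else if i == 0 then s else - s).
(* [e] is the determinant of [N], free of the angle because [c^2 + s^2 = 1]. *)
pose N := diag_mx a *m R *m diag_mx b; pose e := a 0 0 * a 0 1 * (b 0 0 * b 0 1).
have R_real i j : (R i j)^* = R i j.
  by rewrite mxE; case: ifP => _; [|case: ifP => _]; rewrite ?rmorphN /= geC0_conj.
have NE i j : N i j = a 0 i * R i j * b 0 j by rewrite /N mul_mx_diag mxE mul_diag_mx mxE.
have N_real i j : (N i j)^* = N i j by rewrite NE !rmorphM /= R_real !geC0_conj.
have NNE i j : (N *m adjmx N) i j = N i 0 * N j 0 + N i 1 * N j 1.
  by rewrite mxE sum2E !adjmxE !N_real.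
have e0 : 0 <= e by rewrite !mulr_ge0.
have [|||SS trS] := @sqrt_mx2 (N *m adjmx N) e x.
- by rewrite gt_eqF.
- rewrite !NNE !NE !mxE /= /e -[X in _ = (X * _) ^+ 2]mulr1 -cs1; ring.
- rewrite -csx !NNE !NE !mxE /= /e -[X in X *+ 2]mulr1 -cs1 /P /Q; ring.
exists R, (x^-1 *: (N *m adjmx N + e%:M)); split => //.
- apply/unitarymxP/mx2_eq; rewrite [LHS]mxE sum2E !adjmxE !R_real !mxE /= -?cs1; ring.
- apply: psdZ; first by rewrite invr_ge0 ltW.
  by apply: psdD (psd_gram _) _; rewrite -scalemx1; apply: psdZ e0 (psd1 _ _).
Qed.
End Attained.

(** * Interpolation along a transposition, inside a coordinate plane *)

Section Plane.
Variables (C : numClosedFieldType) (d : nat) (p q : 'I_d).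
Hypothesis pNq : p != q.

Definition plane_basis : 'M[C]_(d, 2) := \matrix_(i, k) (i == if k == 0 then p else q)%:R.

Definition off_plane (g : 'rV[C]_d) : 'rV[C]_d :=
  \row_i (if (i == p) || (i == q) then 0 else g 0 i).

Definition on_plane (g : 'rV[C]_d) : 'rV[C]_2 := \row_k (if k == 0 then g 0 p else g 0 q).

(** The direct sum of [B] on the plane of [p], [q] and of [diag g] on the other coordinates, without
    reindexing. The values of [g] at [p] and [q] are masked. *)
Definition plane_mx (B : 'M[C]_2) (g : 'rV[C]_d) : 'M[C]_d :=
  plane_basis *m B *m adjmx plane_basis + diag_mx (off_plane g).

Lemma plane_basis_gram : adjmx plane_basis *m plane_basis = 1%:M.
Proof.
apply/matrixP=> i j; rewrite mxE (eq_bigr (fun k => (plane_basis k i) * plane_basis k j)).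
  rewrite (bigD1 (if j == 0 then p else q)) //= big1 => [|k kN]; last first.
    by rewrite [X in _ * X]mxE (negPf kN) mulr0.
  rewrite !mxE eqxx addr0 mulr1; have qNp := pNq; rewrite eq_sym in qNp.
  by case: (ord2P i) => ->; case: (ord2P j) => ->; rewrite ?eqxx ?(negPf pNq) ?(negPf qNp).
by move=> k _; rewrite adjmxE [in X in X * _]mxE conjC_nat [in RHS]mxE.
Qed.

Lemma off_plane_basis g : diag_mx (off_plane g) *m plane_basis = 0.
Proof.
rewrite mul_diag_mx; apply/matrixP=> i k; rewrite !mxE.
have [->|_] := eqVneq i (if k == 0 then p else q); last by rewrite mulr0.
by case: (ord2P k) => ->; rewrite /= eqxx ?orbT mul0r.
Qed.

Lemma basis_off_plane g : adjmx plane_basis *m diag_mx (off_plane g) = 0.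
Proof.
rewrite mul_mx_diag; apply/matrixP=> k i; rewrite !mxE conjC_nat.
have [->|_] := eqVneq i (if k == 0 then p else q); last by rewrite mul0r.
by case: (ord2P k) => ->; rewrite /= eqxx ?orbT mulr0.
Qed.

Lemma plane_mxM B B' g g' :
  plane_mx B g *m plane_mx B' g' = plane_mx (B *m B') (\row_i (g 0 i * g' 0 i)).
Proof.
rewrite /plane_mx mulmxDl !mulmxDr -!mulmxA (mulmxA (adjmx _) plane_basis).
rewrite plane_basis_gram mul1mx basis_off_plane !mulmx0 addr0.
rewrite (mulmxA (diag_mx _) plane_basis) off_plane_basis !mul0mx add0r.
rewrite mulmx_diag; congr (_ + diag_mx _); apply/rowP=> i; rewrite !mxE.
by case: ifP => // _; rewrite mul0r.
Qed.

Lemma adj_plane_mx B (g : 'rV[C]_d) : (forall i, 0 <= g 0 i) ->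
  adjmx (plane_mx B g) = plane_mx (adjmx B) g.
Proof.
move=> g0; rewrite /plane_mx adjmxD !adjmxM adjmxK mulmxA adjmx_diag // => i.
by rewrite mxE; case: ifP.
Qed.

Lemma psd_plane_mx B (g : 'rV[C]_d) :
  psdmx B -> (forall i, 0 <= g 0 i) -> psdmx (plane_mx B g).
Proof.
move=> Bpsd g0; apply: psdD; last by apply: psd_diag => i; rewrite mxE; case: ifP.
by rewrite -{1}(adjmxK plane_basis); apply: psd_conj.
Qed.

Lemma mxtrace_plane_mx B g :
  \tr (plane_mx B g) = \tr B + \sum_(i | (i != p) && (i != q)) g 0 i.
Proof.
rewrite mxtraceD mxtrace_mulC mulmxA plane_basis_gram mul1mx mxtrace_diag; congr (_ + _).
rewrite [RHS]big_mkcond; apply: eq_bigr => i _; rewrite mxE.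
by case: eqP => //= _; case: eqP.
Qed.

Lemma diag_plane_mx g : diag_mx g = plane_mx (diag_mx (on_plane g)) g.
Proof.
apply/matrixP=> i j; rewrite /plane_mx mul_mx_diag !mxE sum2E !mxE !conjC_nat /= !(eq_sym j).
have qNp := pNq; rewrite eq_sym in qNp.
have [->|iNp] := eqVneq i p.
  by rewrite (negPf pNq) /= mul1r !mul0r mul0rn !addr0 mulr_natr.
have [->|iNq] := eqVneq i q.
  by rewrite mul1r !mul0r mul0rn add0r addr0 mulr_natr.
by rewrite !mul0r !add0r.
Qed.

Lemma attained_swap (a b : 'rV[C]_d) (x : C) :
  (forall i, 0 <= a 0 i) -> (forall i, 0 <= b 0 i) ->
  \sum_i a 0 i * b 0 i < x < \sum_i a 0 i * b 0 (tperm p q i) ->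
  attained a b x.
Proof.
have qNp := pNq; rewrite eq_sym in qNp.
have splitS (F : 'I_d -> C) : \sum_i F i = F p + F q + \sum_(i | (i != p) && (i != q)) F i.
  by rewrite (bigD1 p) //= (bigD1 q) ?addrA.
move=> a0 b0; rewrite !splitS tpermL tpermR.
rewrite [X in _ < x < _ + _ + X](eq_bigr (fun i => a 0 i * b 0 i)); last first.
  move=> i /andP[ip iq].
  by rewrite tpermD // eq_sym.
set rest := \sum_(i | _) _ => x_between.
have on0 (g : 'rV[C]_d) : (forall i, 0 <= g 0 i) -> forall i, 0 <= on_plane g 0 i.
  by move=> g0 i; rewrite mxE; case: ifP.
(* Coordinates other than [p] and [q] contribute [rest] to both ends, so the plane has to produce
   [x - rest]. *)
have := @rotation_interpolation C (on_plane a) (on_plane b) (x - rest) (on0 _ a0) (on0 _ b0).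
rewrite !mxE /= ltrBrDr ltrBlDr => /(_ x_between) [R [S [RU Spsd SS trS]]].
pose ab := \row_i (a 0 i * b 0 i).
have ab0 i : 0 <= ab 0 i by rewrite mxE mulr_ge0.
have c1E : 1%:M = plane_mx 1%:M (const_mx 1).
  rewrite -diag_const_mx [LHS]diag_plane_mx; congr (plane_mx _ _).
  by rewrite -diag_const_mx; congr diag_mx; apply/rowP=> i; rewrite !mxE if_same.
(* The rotation is extended by the identity and the root by the products [a_i b_i], whose sum off
   the plane is [rest]. *)
exists (plane_mx R (const_mx 1)), (plane_mx S ab) => N.
have NE : N = plane_mx (diag_mx (on_plane a) *m R *m diag_mx (on_plane b)) ab.
  rewrite /N (diag_plane_mx a) (diag_plane_mx b) !plane_mxM; congr plane_mx.
  by apply/rowP=> i; rewrite !mxE mulr1.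
split.
- apply/unitarymx_adjP; rewrite adj_plane_mx => [|i]; last by rewrite mxE ler01.
  rewrite plane_mxM unitarymxE // c1E; congr plane_mx.
  by apply/rowP=> i; rewrite !mxE mulr1.
- exact: psd_plane_mx.
- by rewrite NE adj_plane_mx // !plane_mxM SS.
- rewrite mxtrace_plane_mx trS /rest -[RHS](subrK rest); congr (_ + _).
  by apply: eq_bigr => i _; rewrite mxE.
Qed.

End Plane.

(** * Chains of transpositions and passage to the fidelity *)

Section Permutations.
Variables (C : numClosedFieldType) (d : nat).
Implicit Types (a b : 'rV[C]_d) (s : 'S_d).

(** Replacing [V] by [V *m perm_mx s] multiplies [N] on the right by a unitary, so [N N^*] and its
    root [S] are unchanged. *)
Lemma attained_perm a b s x :
  attained a (\row_i b 0 (s i)) x -> attained a b x.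
Proof.
move=> [V [S [VU Spsd SS trS]]]; exists (V *m perm_mx s), S.
have PU : perm_mx s \is @unitarymx C d d.
  apply/unitarymx_adjP; rewrite /adjmx tr_perm_mx map_perm_mx -perm_mxM mulgV.
  exact: perm_mx1.
have bE : diag_mx (\row_i b 0 (s i)) = perm_mx s *m diag_mx b *m adjmx (perm_mx s).
  rewrite /adjmx tr_perm_mx map_perm_mx -row_permE -col_permE.
  apply/matrixP=> i j; rewrite !mxE (inj_eq perm_inj).
  by case: eqP => // ->.
have -> : diag_mx a *m (V *m perm_mx s) *m diag_mx b
        = (diag_mx a *m V *m diag_mx (\row_i b 0 (s i))) *m perm_mx s.
  by rewrite bE !mulmxA mulmxKtV.
split=> //; first exact: mul_unitarymx.
by rewrite adjmxM mulmxA mulmxtVK.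
Qed.

Lemma attained_diag a b s : (forall i, 0 <= a 0 i) -> (forall i, 0 <= b 0 i) ->
  attained a b (\sum_i a 0 i * b 0 (s i)).
Proof.
move=> a0 b0; apply: (@attained_perm _ _ s).
set c := \row_i _; have c0 i : 0 <= c 0 i by rewrite mxE.
exists 1%:M, (diag_mx a *m diag_mx c); split.
- by apply/unitarymx_adjP; rewrite adjmx1 mulmx1.
- by rewrite mulmx_diag; apply: psd_diag => i; rewrite mxE mulr_ge0.
- by rewrite mulmx1 adjmxM !adjmx_diag // (diag_mxC c).
- by rewrite mulmx_diag mxtrace_diag; apply: eq_bigr => i _; rewrite !mxE.
Qed.

(** A discrete intermediate value argument, by induction on a factorization of [u * s^-1] into
    transpositions. *)
Lemma attained_between a b s (u : 'S_d) x : (forall i, 0 <= a 0 i) -> (forall i, 0 <= b 0 i) ->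
  \sum_i a 0 i * b 0 (s i) <= x <= \sum_i a 0 i * b 0 (u i) -> attained a b x.
Proof.
move=> a0 b0; pose val (v : 'S_d) := \sum_i a 0 i * b 0 (v i).
have val_ge0 (v : 'S_d) : 0 <= val v by rewrite sumr_ge0 // => i _; rewrite mulr_ge0.
move=> /andP[]; rewrite -/(val s) -/(val u) => le_sx.
(* Nonnegativity makes [x] comparable with every [val v] in the partial order of [C]. *)
have x0 : 0 <= x := le_trans (val_ge0 s) le_sx.
have [ts uE /allP tsD] := prod_tpermP (u * s^-1)%g.
rewrite (_ : u = (\prod_(t <- ts) tperm t.1 t.2) * s)%g; last by rewrite -uE mulgKV.
elim: ts tsD {uE} => [|[p q] ts IHts] tsD.
  rewrite big_nil mul1g => le_xs; have -> : x = val s by apply/le_anti; rewrite le_xs.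
  exact: attained_diag.
rewrite big_cons /= -mulgA; set v := (_ * s)%g in IHts *.
have pq : p != q by apply: (tsD (p, q)); rewrite mem_head.
(* Either [x] is already reached by the shorter chain, or it lies in the link from [v] to
   [tperm p q * v]. *)
have [le_xv|lt_vx] := real_leP (ger0_real x0) (ger0_real (val_ge0 v)).
  by move=> _; apply: IHts => // t t_ts; apply: tsD; rewrite inE t_ts orbT.
rewrite le_eqVlt => /predU1P[->|lt_xv]; first exact: attained_diag.
apply: (@attained_perm _ _ v); apply: (attained_swap pq) => // [i|]; first by rewrite mxE.
have -> : \sum_i a 0 i * (\row_j b 0 (v j)) 0 i = val v.
  by apply: eq_bigr => i _; rewrite mxE.
have -> : \sum_i a 0 i * (\row_j b 0 (v j)) 0 (tperm p q i) = val (tperm p q * v)%g.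
  by apply: eq_bigr => i _; rewrite mxE permM.
by rewrite lt_vx.
Qed.

(** With [R], [Q] diagonalizing [rho], [sigma] and [U = R^* V Q], the matrix under the root is
    [R^* N N^* R], the square of the positive matrix [R^* S R], whose trace is [tr S]. *)
Lemma attained_fidelity (rho sigma : 'M[C]_d) (x : C) :
  psdmx rho -> psdmx sigma ->
  attained (map_mx sqrtC (spectral_diag rho)) (map_mx sqrtC (spectral_diag sigma)) x ->
  exists U : 'M[C]_d, U \is unitarymx /\ fidelity rho (U *m sigma *m adjmx U) = x.
Proof.
move=> rho_psd sigma_psd [V [S [VU Spsd SS <-]]].
have [RU QU] := (spectral_unitarymx rho, spectral_unitarymx sigma).
exists (adjmx (spectralmx rho) *m V *m spectralmx sigma); split.
  by rewrite !mul_unitarymx // adjmx_unitary.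
rewrite /fidelity (sqrtmxE rho) {2}(psd_spectralE sigma_psd).
move: SS (fun i => spectral_diag_ge0 i rho_psd) (fun i => spectral_diag_ge0 i sigma_psd).
move: (spectralmx rho) (spectralmx sigma) (spectral_diag rho) (spectral_diag sigma) RU QU.
move=> R Q x1 x2 RU QU SS x1_ge0 x2_ge0.
transitivity (\tr (sqrtmx ((adjmx R *m S *m R) *m (adjmx R *m S *m R)))); last first.
  rewrite sqrtmx_sqr; last exact: psd_conj.
  by rewrite mxtrace_mulC mulmxA unitarymxE // mul1mx.
congr (\tr (sqrtmx _)).
rewrite !mulmxA [in RHS]mulmxtVK // -(mulmxA _ S S) SS !adjmxM adjmxK -(diag_sqrtCK x2).
have a0 i : 0 <= map_mx sqrtC x1 0 i by rewrite mxE sqrtC_ge0.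
have b0 i : 0 <= map_mx sqrtC x2 0 i by rewrite mxE sqrtC_ge0.
rewrite (adjmx_diag a0) (adjmx_diag b0) !mulmxA.
by rewrite !mulmxtVK.
Qed.

End Permutations.

(** Both ends of the interval become pairings of the unsorted spectra along a permutation, the form
    that [attained_between] takes. *)
Lemma sum_perm_sorted (C : numClosedFieldType) d (rho sigma : 'M[C]_d) (le1 le2 : rel C) :
  psdmx rho -> psdmx sigma ->
  exists u : 'S_d,
    \sum_(j < d) sqrtC ((sort le1 [seq spectral_diag rho 0 i | i <- enum 'I_d])`_j *
                        (sort le2 [seq spectral_diag sigma 0 i | i <- enum 'I_d])`_j)
    = \sum_i map_mx sqrtC (spectral_diag rho) 0 i * map_mx sqrtC (spectral_diag sigma) 0 (u i).
Proof.
move=> rho_psd sigma_psd.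
have [r rE] := spectral_perm rho le1; have [s sE] := spectral_perm sigma le2.
exists (r^-1 * s)%g; rewrite [RHS](reindex_perm r); apply: eq_bigr => i _.
by rewrite -rE -sE permM permK !mxE sqrtCM ?nnegrE ?spectral_diag_ge0.
Qed.

Unset Implicit Arguments.

Theorem theorem2 (C : numClosedFieldType) (d : nat) (rho sigma : 'M[C]_d) :
  densitymx rho -> densitymx sigma ->
  forall x : C,
    (exists U : 'M[C]_d, U \is unitarymx /\ fidelity rho (U *m sigma *m adjmx U) = x)
    <->
    (\sum_(j < d) sqrtC ((eigs_down rho)`_j * (eigs_up sigma)`_j) <= x <=
     \sum_(j < d) sqrtC ((eigs_down rho)`_j * (eigs_down sigma)`_j)).
Proof.
move=> [rho_psd _] [sigma_psd _] x; split=> [[U [UU <-]]|].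
  by rewrite fidelity_ge ?fidelity_le.
have [s ->] := sum_perm_sorted (fun x y => y <= x) (fun x y => x <= y) rho_psd sigma_psd.
have [u ->] := sum_perm_sorted (fun x y => y <= x) (fun x y => y <= x) rho_psd sigma_psd.
move=> x_between; apply: attained_fidelity => //; apply: attained_between x_between.
  by move=> i; rewrite mxE sqrtC_ge0 spectral_diag_ge0.
by move=> i; rewrite mxE sqrtC_ge0 spectral_diag_ge0.
Qed.
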